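(* Let $R=(r_{ij})$ be a real symmetric $n\times n$ matrix with zero diagonal and $\rho(|R|)<1$, let $G$ be its graph, assumed to contain a cycle, with girth $g$, and let $Z=\det(I-R)^{-1}$ and $Z^{\mathrm{bp}}$ be the belief-propagation estimate (defined in the context). Then $$\frac1n\left|\log\frac{Z^{\mathrm{bp}}}{Z}\right|\le\frac{\rho(|R|)^g}{g\,(1-\rho(|R|))}.$$
   Context: $|R|=(|r_{ij}|)$ is the entrywise absolute value and $\rho$ the spectral radius. $G$ is the graph on $V=\{1,\dots,n\}$ with undirected edge $\{i,j\}$ whenever $r_{ij}\neq0$; $\partial i$ is the set of neighbours of $i$. The girth $g$ is the length of the shortest cycle of $G$. GaBP messages: for each directed edge $(ij)$ ($\{i,j\}\in G$), $\alpha_{ij}=\lim_t\alpha^{(t)}_{ij}$ with $\alpha^{(0)}_{ij}=0$, $\alpha^{(t+1)}_{ij}=r_{ij}^2(1-\sum_{k\in\partial i\setminus j}\alpha^{(t)}_{ki})^{-1}$ (convergent when $\rho(|R|)<1$). $\alpha_{i\setminus j}=\sum_{k\in\partial i\setminus j}\alpha_{ki}$. $Z_i^{\mathrm{bp}}=(1-\sum_{k\in\partial i}\alpha_{ki})^{-1}$, $Z_{ij}^{\mathrm{bp}}=\det\begin{pmatrix}1-\alpha_{i\setminus j} & -r_{ij}\\ -r_{ij} & 1-\alpha_{j\setminus i}\end{pmatrix}^{-1}$, and $Z^{\mathrm{bp}}=\prod_{i\in V}Z_i^{\mathrm{bp}}\prod_{\{i,j\}\in G}\frac{Z_{ij}^{\mathrm{bp}}}{Z_i^{\mathrm{bp}}Z_j^{\mathrm{bp}}}$.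 *)

(* Defs.v *)
From HB Require Import structures.
From mathcomp Require Import all_boot all_order all_algebra.
From mathcomp Require Import all_classical all_reals all_analysis.
From mathcomp Require Import complex.

Set Implicit Arguments.
Unset Strict Implicit.
Unset Printing Implicit Defensive.

Import Order.TTheory GRing.Theory Num.Theory numFieldNormedType.Exports.
Local Open Scope ring_scope.
Local Open Scope classical_set_scope.

Section GaBP.
Variables (R : realType) (n : nat).
Implicit Types (A : 'M[R]_n).

Definition absmx A : 'M[R]_n := map_mx (fun x => `|x|) A.

Definition spectral_radius A : R :=
  sup [set ComplexField.Normc.normc l | l in
        [set l : R[i] | eigenvalue (map_mx (fun x : R => x%:C%C) A) l]].

Definition adj A (i j : 'I_n) : bool := A i j != 0.

Definition is_cycle A (k : nat) (c : 'I_k -> 'I_n) : Prop :=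
  (3 <= k)%N /\ injective c /\ forall t : 'I_k, adj A (c t) (c (ordS t)).

Definition has_cycle_of_length A (k : nat) : Prop :=
  exists c : 'I_k -> 'I_n, is_cycle A c.

Definition is_girth A (g : nat) : Prop :=
  has_cycle_of_length A g /\ forall k, (k < g)%N -> ~ has_cycle_of_length A k.

(* GaBP iteration alpha^(t)_{ij} (only meaningful on edges; zero otherwise) *)
Fixpoint alpha_seq A (t : nat) : 'I_n -> 'I_n -> R :=
  match t with
  | 0%N => fun _ _ => 0
  | t'.+1 => fun i j =>
      A i j ^+ 2 *
      (1 - \sum_(k | adj A i k && (k != j)) alpha_seq A t' k i)^-1
  end.

Definition alpha A (i j : 'I_n) : R := limn (fun t => alpha_seq A t i j).

Definition alpha_excl A (i j : 'I_n) : R :=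
  \sum_(k | adj A i k && (k != j)) alpha A k i.

Definition Zbp_node A (i : 'I_n) : R :=
  (1 - \sum_(k | adj A i k) alpha A k i)^-1.

Definition Zbp_edge A (i j : 'I_n) : R :=
  (\det (\matrix_(a < 2, b < 2)
           nth 0 (nth [::] [:: [:: 1 - alpha_excl A i j; - A i j];
                               [:: - A i j; 1 - alpha_excl A j i]] a) b))^-1.

Definition Zbp A : R :=
  (\prod_(i : 'I_n) Zbp_node A i) *
  \prod_(i : 'I_n) \prod_(j : 'I_n | (i < j)%N && adj A i j)
     (Zbp_edge A i j / (Zbp_node A i * Zbp_node A j)).

Definition Zpart A : R := (\det (1%:M - A))^-1.

End GaBP.

(* Main.v *)
(* Put B = |A| and G = (1 - B)^-1, and let alpha be the limit messages. With the
   dressed weights w_ij = A_ij / (1 - alpha_{j\i}) and the nonbacktracking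
   operator W on directed edges, W_{(i,j),(j,k)} = w_jk for k <> i, an Ihara-Bass
   computation gives Zbp / Z = det (1 - W).  Differentiating ln det (1 - s W) in
   s, and using that |W|^k has zero trace for 0 < k < g,
     g |ln det (1 - W)| <= sum_(k >= g) tr |W|^k.
   Walks of B are nonbacktracking walks of |W| with backtracking excursions
   inserted, so the right-hand side is at most sum_i (G_ii - Zbp_i).  Below the
   girth every closed walk is totally backtracking, and Zbp_i is the Green
   function of the universal cover, so Zbp_i >= sum_(k < g) (B^k)_ii.  What
   remains is tr (B^g G) <= n rho^g / (1 - rho), by the spectral theorem. *)

Require Import Defs.
From HB Require Import structures.
From mathcomp Require Import all_boot all_order all_algebra.
From mathcomp Require Import all_classical all_reals all_analysis.
From mathcomp Require Import complex ring zify perm.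

Import Order.TTheory GRing.Theory Num.Theory numFieldNormedType.Exports.
Local Open Scope ring_scope.

Set Implicit Arguments.
Unset Strict Implicit.
Unset Printing Implicit Defensive.

(** * Traces of powers and the resolvent *)

(** [sup] dominates only sets that are bounded above. The eigenvalues are the finitely many roots of
    the characteristic polynomial, and the sum of the moduli of these roots is an upper bound. *)
Lemma eigenvalue_normc_le (R : realType) (n : nat) (B : 'M[R]_n) (l : R[i]) :
  eigenvalue (map_mx (fun x : R => x%:C%C) B) l ->
  ComplexField.Normc.normc l <= spectral_radius B.
Proof.
move=> hl; apply: ub_le_sup; last by exists l.
set M := map_mx _ B in hl *.
have [rs hrs] := closed_field_poly_normal (char_poly M).
exists (\sum_(r <- rs) ComplexField.Normc.normc r) => _ [r hr <-].
move: hr; rewrite /= -/M eigenvalue_root_char hrs.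
rewrite (monicP (char_poly_monic M)) scale1r root_prod_XsubC => rin.
rewrite (big_rem r) //= lerDl sumr_ge0 // => z _.
by rewrite -lecR; exact: (normr_ge0 z).
Qed.

Lemma spectral_radius_ge0 (R : realType) (n : nat) (B : 'M[R]_n) :
  (0 < n)%N -> 0 <= spectral_radius B.
Proof.
move=> n0; have [l hl] := eigenvalue_closed (map_mx (fun x : R => x%:C%C) B) n0.
by apply: le_trans (eigenvalue_normc_le hl); rewrite -lecR; exact: (normr_ge0 l).
Qed.

Lemma map_mx_expr (F F' : pzRingType) (f : {rmorphism F -> F'}) (n : nat) (M : 'M[F]_n) (k : nat) :
  map_mx f (M ^+ k) = map_mx f M ^+ k.
Proof.
elim: k => [|k IH]; first by rewrite !expr0; exact: map_mx1.
by rewrite !exprS -IH -[M * _]/(M *m _) map_mxM.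
Qed.

Lemma expmx_diagonalized (F : fieldType) (n : nat) (M P : 'M[F]_n) (d : 'rV_n) (k : nat) :
  P \in unitmx -> M = invmx P *m diag_mx d *m P ->
  M ^+ k = invmx P *m diag_mx (map_mx (fun x => x ^+ k) d) *m P.
Proof.
move=> Pu hM; elim: k => [|k IH].
  rewrite expr0 -[LHS](mulVmx Pu); congr (_ *m _).
  rewrite -[LHS]mulmx1; congr (_ *m _).
  by apply/matrixP => i j; rewrite !mxE expr0.
rewrite exprSr IH {1}hM -[LHS]/(_ *m _) !mulmxA mulmxK //; congr (_ *m _).
rewrite -!mulmxA; congr (_ *m _); rewrite mulmx_diag; congr diag_mx.
by apply/rowP => i; rewrite !mxE exprSr.
Qed.

Lemma mxtrace_diagonalized (F : fieldType) (n : nat) (M P : 'M[F]_n) (d : 'rV_n) (k : nat) :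
  P \in unitmx -> M = invmx P *m diag_mx d *m P ->
  \tr (M ^+ k) = \sum_i d 0 i ^+ k.
Proof.
move=> Pu hM; rewrite (expmx_diagonalized k Pu hM) -mulmxA mxtrace_mulC mulmxK // mxtrace_diag.
by apply: eq_bigr => i _; rewrite mxE.
Qed.

Lemma eigenvalue_diagonalized (F : fieldType) (n : nat) (M P : 'M[F]_n) (d : 'rV_n) i :
  P \in unitmx -> M = invmx P *m diag_mx d *m P -> eigenvalue M (d 0 i).
Proof.
move=> Pu hM; apply/eigenvalueP; exists (row i P).
  rewrite {1}hM -row_mul -(mulmxA (invmx P)) mulKVmx //.
  apply/rowP => j; rewrite !mxE (bigD1 i) //= mxE eqxx big1 ?addr0 //.
  by move=> l li; rewrite mxE eq_sym (negPf li) mul0r.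
apply: contraTneq Pu => Pi; rewrite unitmxE.
suff -> : \det P = 0 by rewrite unitr0.
apply/eqP/det0P; exists (delta_mx 0 i); last by rewrite -rowE.
by apply/eqP => /rowP/(_ i)/eqP; rewrite !mxE !eqxx oner_eq0.
Qed.

(** A real symmetric matrix is normal over [R[i]], hence diagonalizable, so the trace is a sum of
    [n] powers of eigenvalues of modulus at most the spectral radius. *)
Lemma mxtrace_expr_le (R : realType) (n : nat) (B : 'M[R]_n) (k : nat) :
  (forall i j, B i j = B j i) ->
  `|\tr (B ^+ k)| <= n%:R * spectral_radius B ^+ k.
Proof.
move=> Bs; set M := map_mx (fun x : R => x%:C%C) B.
have /orthomx_spectralP : M \is normalmx.
  apply: symmetric_normalmx.
    by apply/eqP; rewrite expr0 scale1r map_mx_id //; apply/matrixP => i j; rewrite !mxE Bs.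
  by apply/mxOverP => i j; rewrite mxE; apply/complex_realP; exists (B i j).
have := spectral_unit M; move: (spectralmx M) (spectral_diag M) => P d Pu /= hM.
have trE : (\tr (B ^+ k))%:C%C = \sum_i d 0 i ^+ k.
  have -> : (\tr (B ^+ k))%:C%C = \tr (M ^+ k).
    by rewrite -(map_mx_expr (real_complex R)) -(trace_map_mx (real_complex R)).
  exact: mxtrace_diagonalized Pu hM.
have ev i : eigenvalue M (d 0 i) := eigenvalue_diagonalized i Pu hM.
have -> : n%:R * spectral_radius B ^+ k = \sum_(i < n) spectral_radius B ^+ k.
  by rewrite sumr_const card_ord mulr_natl.
rewrite -lecR; apply: (@le_trans _ _ `|(\tr (B ^+ k))%:C%C|).
  by rewrite normc_def /= expr0n addr0 sqrtr_sqr.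
rewrite trE; apply: le_trans (ler_norm_sum _ _ _) _.
rewrite (rmorph_sum (real_complex R)) ler_sum // => i _.
rewrite normrX rmorphXn /= lerXn2r ?nnegrE ?normr_ge0 //.
  rewrite lecR spectral_radius_ge0 //; exact: leq_ltn_trans (ltn_ord i).
by rewrite -[leLHS]/((ComplexField.Normc.normc _)%:C%C) lecR eigenvalue_normc_le.
Qed.

Lemma mulmx_ge0 (R : numDomainType) (m n p : nat) (X : 'M[R]_(m, n)) (Y : 'M[R]_(n, p)) :
  (forall i j, 0 <= X i j) -> (forall i j, 0 <= Y i j) ->
  forall i j, 0 <= (X *m Y) i j.
Proof. by move=> hX hY i j; rewrite mxE sumr_ge0 // => k _; rewrite mulr_ge0. Qed.

Lemma expmx_ge0 (R : numDomainType) (n : nat) (X : 'M[R]_n) (k : nat) :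
  (forall i j, 0 <= X i j) -> forall i j, 0 <= (X ^+ k) i j.
Proof.
move=> hX; elim: k => [|k IH]; last by rewrite exprS; exact: mulmx_ge0.
by move=> i j; rewrite expr0 mxE; case: (_ == _).
Qed.

(** Neumann expansion cut after [K] terms, with its exact remainder. [T] and [G] may be rectangular,
    since edge-by-vertex matrices are expanded too. *)
Lemma geometric_mx (R : pzRingType) (n p : nat) (B : 'M[R]_n) (T G : 'M[R]_(n, p)) (K : nat) :
  G = T + B *m G -> G = \sum_(k < K) B ^+ k *m T + B ^+ K *m G.
Proof.
move=> GE; elim: K => [|K IH]; first by rewrite big_ord0 add0r expr0 mul1mx.
by rewrite big_ord_recr /= {1}IH {1}GE mulmxDr mulmxA addrA exprSr.
Qed.

Lemma geometric_mx1 (R : pzRingType) (n : nat) (B G : 'M[R]_n) (K : nat) :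
  G = 1%:M + B *m G -> G = \sum_(k < K) B ^+ k + B ^+ K *m G.
Proof.
by move=> /(geometric_mx K) {1}->; under eq_bigr do rewrite mulmx1.
Qed.

(** * Decay of the powers of [B], and its nonnegative resolvent *)

Section Resolvent.
Local Open Scope classical_set_scope.
Local Open Scope ring_scope.
Variables (R : realType) (n : nat) (B : 'M[R]_n).
Hypothesis Bsym : forall i j, B i j = B j i.
Hypothesis Bge0 : forall i j, 0 <= B i j.
Hypothesis rho_lt1 : spectral_radius B < 1.
Let rho := spectral_radius B.

(* Symmetry gives [(B^k)_ij ^ 2 <= (B^(2k))_ii <= tr B^(2k)]. *)
Lemma expmx_entry_le k i j : `|(B ^+ k) i j| ^+ 2 <= n%:R * (rho ^+ k) ^+ 2.
Proof.
have sym : forall a b, (B ^+ k) a b = (B ^+ k) b a.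
  move=> a b; suff h : (B ^+ k)^T = B ^+ k by rewrite -{1}h mxE.
  elim: k => [|k IH]; first by rewrite expr0; exact: trmx1.
  rewrite {1}exprS -[_ * _]/(_ *m _) trmx_mul IH exprSr; congr (_ *m _).
  by apply/matrixP => a' b'; rewrite mxE Bsym.
rewrite -exprM muln2 real_normK ?num_real //.
apply: le_trans (mxtrace_expr_le (k.*2) Bsym).
apply: le_trans (ler_norm _).
have Bk a b : 0 <= (B ^+ k.*2) a b by exact: expmx_ge0.
rewrite /mxtrace (bigD1 i) //=.
apply: (@le_trans _ _ ((B ^+ k.*2) i i)); last by rewrite lerDl sumr_ge0.
rewrite -addnn exprD -[_ * _]/(_ *m _) mxE (bigD1 j) //= -sym -expr2 lerDl sumr_ge0 //.
by move=> l _; rewrite mulr_ge0 // expmx_ge0.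
Qed.

Lemma cvg_sumr (I : Type) (r : seq I) (f : I -> nat -> R) (l : I -> R) :
  (forall k, f k @ \oo --> l k) ->
  (fun t => \sum_(k <- r) f k t) @ \oo --> \sum_(k <- r) l k.
Proof. by move=> h; apply: cvg_big => //; exact: add_continuous. Qed.

Lemma cvg_expmx i j : (fun k => (B ^+ k) i j) @ \oo --> (0 : R).
Proof.
have n0 : (0 < n)%N by exact: leq_ltn_trans (ltn_ord i).
have rho0 : 0 <= rho by exact: spectral_radius_ge0.
have hcvg : (fun k => n%:R * rho ^+ k) @ \oo --> (0 : R).
  by rewrite -[0](mulr0 n%:R); apply: cvgMr; apply: cvg_expr; rewrite ger0_norm.
apply: (@squeeze_cvgr _ _ _ _ (fun=> 0) (fun k => n%:R * rho ^+ k)) => //; last exact: cvg_cst.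
near=> k; rewrite expmx_ge0 //=.
rewrite -(ger0_norm (expmx_ge0 k Bge0 i j)).
rewrite -(@ler_pXn2r _ 2) ?nnegrE ?mulr_ge0 ?exprn_ge0 //.
apply: le_trans (expmx_entry_le k i j) _.
(* Enlarging the factor [n] to [n ^ 2] turns the bound into a square, so no square root is taken. *)
rewrite exprMn ler_wpM2r ?exprn_ge0 // -natrX ler_nat.
by rewrite -{1}(expn1 n) leq_pexp2l.
Unshelve. all: by end_near. Qed.

Lemma cvg_expmxM (p : nat) (X : 'M[R]_(n, p)) i j :
  (fun k => (B ^+ k *m X) i j) @ \oo --> (0 : R).
Proof.
have -> : (fun k => (B ^+ k *m X) i j) = (fun k => \sum_l (B ^+ k) i l * X l j).
  by apply: funext => k; rewrite mxE.
rewrite [L in _ --> L](_ : 0 = \sum_(l < n) 0 * X l j); last first.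
  by rewrite big1 // => l _; rewrite mul0r.
apply: cvg_sumr => l; apply: cvgMl; exact: cvg_expmx.
Qed.

(** The transpose of a kernel vector is fixed by [B], hence by all powers of [B], which tend to
    0. *)
Lemma unitmx_1subB : 1%:M - B \in unitmx.
Proof.
rewrite unitmxE unitfE; apply/det0P => -[v /eqP v0 vB]; apply: v0.
have hv : v^T = B *m v^T.
  apply/eqP; rewrite -subr_eq0 -{1}[v^T]mul1mx -mulmxBl; apply/eqP.
  have -> : 1%:M - B = (1%:M - B)^T.
    by apply/matrixP => a b; rewrite !mxE Bsym eq_sym.
  by rewrite -trmx_mul vB trmx0.
have hvk k : v^T = B ^+ k *m v^T.
  elim: k => [|k IH]; first by rewrite expr0 mul1mx.
  by rewrite exprSr -mulmxA -hv.
apply/rowP => i; rewrite [RHS]mxE.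
have := @cvg_expmxM _ v^T i 0.
have -> : (fun k => (B ^+ k *m v^T) i 0) = fun=> v 0 i.
  by apply: funext => k; rewrite -hvk mxE.
by move=> /(cvg_unique _ (@cvg_cst _ (v 0 i) nat \oo _)); apply.
Qed.

Let G := invmx (1%:M - B).

Lemma resolventE : G = 1%:M + B *m G.
Proof. 
apply/eqP; rewrite -subr_eq; apply/eqP.
by rewrite -{1}[G]mul1mx -mulmxBl mulmxV // unitmx_1subB.
Qed.

(** [G - B ^+ k *m G] is a partial Neumann sum with nonnegative entries, and the correction tends to
    0. *)
Lemma resolvent_ge0 i j : 0 <= G i j.
Proof.
have h : (fun k => G i j - (B ^+ k *m G) i j) @ \oo --> G i j - 0.
  by apply: cvgB; [exact: cvg_cst | exact: cvg_expmxM].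
rewrite subr0 in h; rewrite -(cvg_lim _ h) //.
apply: limr_ge; first by apply/cvg_ex; exists (G i j).
near=> k; rewrite {1}(geometric_mx1 k resolventE) mxE addrK summxE sumr_ge0 // => l _.
exact: expmx_ge0.
Unshelve. all: by end_near. Qed.

Lemma trace_tail_le g :
  \tr G - \sum_(k < g) \tr (B ^+ k) <= n%:R * rho ^+ g / (1 - rho).
Proof.
(* For [n = 0] no eigenvalue is available to make [rho] nonnegative, but both sides vanish. *)
have [n0|n0] := posnP n.
  have tr0 (X : 'M[R]_n) : \tr X = 0.
    by rewrite /mxtrace big1 // => i; have := ltn_ord i; rewrite {2}n0.
  have -> : n%:R = 0 :> R by rewrite n0.
  by rewrite !mul0r tr0 big1 ?subr0.
have rho0 : 0 <= rho by exact: spectral_radius_ge0.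
(* Traces of order [g] to [g + K - 1] form a geometric sum bounded uniformly in [K]; the remainder
   is sent to 0 afterwards. *)
have tail K : \tr G - \sum_(k < g) \tr (B ^+ k) - \tr (B ^+ (g + K) *m G)
     <= n%:R * rho ^+ g / (1 - rho).
  rewrite {1}(geometric_mx1 (g + K) resolventE) mxtraceD addrAC addrK.
  rewrite raddf_sum big_split_ord /= addrAC subrr add0r.
  apply: (@le_trans _ _ (\sum_(k < K) n%:R * rho ^+ g * rho ^+ k)).
    apply: ler_sum => k _; rewrite -mulrA -exprD.
    exact: le_trans (ler_norm _) (mxtrace_expr_le _ Bsym).
  rewrite -mulr_sumr ler_wpM2l ?mulr_ge0 ?exprn_ge0 //.
  have h : 0 < 1 - rho by rewrite subr_gt0.
  rewrite -[leRHS]mul1r ler_pdivlMr // mulrC.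
  have := subrX1 rho K => hE.
  have -> : (1 - rho) * \sum_(k < K) rho ^+ k = 1 - rho ^+ K.
    by rewrite -[1 - rho]opprB mulNr -hE opprB.
  by rewrite lerBlDr lerDl exprn_ge0.
set c := _ - _ in tail *.
have h : (fun K => c - \tr (B ^+ (g + K) *m G)) @ \oo --> c - 0.
  apply: cvgB; first exact: cvg_cst.
  rewrite [L in _ --> L](_ : 0 = \sum_(l < n) 0); last by rewrite big1.
  apply: cvg_sumr => l.
  have := @cvg_expmxM _ G l l; rewrite -(@cvg_shiftn g) /=.
  by under [in X in X -> _]eq_fun do rewrite addnC.
rewrite subr0 in h; rewrite -(cvg_lim _ h) //.
apply: limr_le; first by apply/cvg_ex; exists c.
by near=> K; exact: tail.
Unshelve. all: by end_near. Qed.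

End Resolvent.

(** * Nonbacktracking walks and the universal cover *)

Section NonBacktracking.
Variables (R : realType) (n : nat) (B : 'M[R]_n).
Hypothesis Bsym : forall i j, B i j = B j i.
Hypothesis Bdiag : forall i, B i i = 0.

(** The most recent vertex comes first, so that extending or retracting a walk acts on the head of
    the list. *)
Fixpoint nbwalk (s : seq 'I_n) : bool :=
  if s is b :: s1 then
    if s1 is a :: s2 then
      [&& adj B b a, (if s2 is c :: _ then b != c else true) & nbwalk s1]
    else true
  else true.

Lemma nbwalk_nth (i0 : 'I_n) s t : nbwalk s ->
  ((t.+1 < size s)%N -> adj B (nth i0 s t) (nth i0 s t.+1)) /\
  ((t.+2 < size s)%N -> nth i0 s t != nth i0 s t.+2).
Proof.
elim: s t => [|b [|a s] IH] // t /and3P[ba bc nb].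
case: t => [|t]; last exact: IH.
by split=> //=; case: s bc {IH nb}.
Qed.

Lemma adj_neq i j : adj B i j -> i != j.
Proof. by rewrite /adj; apply: contraNneq => ->; rewrite Bdiag. Qed.

(** Take two equal vertices of the walk at the smallest gap [d]. Gaps 1 and 2 are excluded by the
    zero diagonal and by nonbacktracking, and minimality makes the [d] vertices of the window
    distinct. *)
Lemma closed_nbwalk_cycle i s : nbwalk (i :: s) -> last i s = i -> s != [::] ->
  exists2 k, (k <= size s)%N & has_cycle_of_length B k.
Proof.
move=> nb li s0.
pose c t := nth i (i :: s) t.
pose rep d := (0 < d)%N &&
  [exists t : 'I_(size s).+1, (t + d <= size s)%N && (c t == c (t + d)%N)].
have exd : exists d, rep d.
  exists (size s); rewrite /rep lt0n size_eq0 s0 /=; apply/existsP; exists ord0.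
  by rewrite add0n leqnn /= /c nth_last /= li.
case: (ex_minnP exd) => d /andP[d0 /existsP[t /andP[td /eqP ct]]] dmin.
have d3 : (2 < d)%N.
  case: d d0 td ct {dmin} => [|[|[|d]]] // _ td ct.
    have [+ _] := nbwalk_nth i t nb; rewrite ltnS -addn1 => /(_ td)/adj_neq.
    by move: ct; rewrite /c addn1 => ->; rewrite eqxx.
  have [_ +] := nbwalk_nth i t nb; rewrite ltnS -addn2 => /(_ td).
  by move: ct; rewrite /c addn2 => ->; rewrite eqxx.
exists d; first by lia.
have inj x y : (x < y)%N -> (y < d)%N -> c (t + x)%N = c (t + y)%N -> False.
  move=> xy yd cxy; suff /dmin : rep (y - x)%N by lia.
  rewrite /rep subn_gt0 xy /=; apply/existsP.
  have h : (t + x < (size s).+1)%N by lia.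
  exists (Ordinal h) => /=; have -> : (t + x + (y - x) = t + y)%N by lia.
  by rewrite cxy eqxx andbT; lia.
exists (fun x : 'I_d => c (t + x)%N); split=> //; split.
  move=> x y cxy; apply: val_inj => /=.
  case: (ltngtP x y) => // xy; [have := ltn_ord y | have := ltn_ord x] => h.
    by case: (inj _ _ xy h).
  by case: (inj _ _ xy h).
move=> x; have xd := ltn_ord x.
have [+ _] := nbwalk_nth i (t + x)%N nb.
have -> : ((t + x).+1 < size (i :: s))%N by rewrite /=; lia.
move=> /(_ isT); rewrite -/(c _) -/(c _).
suff -> : c (t + x).+1 = c (t + ordS x)%N by [].
rewrite /=; have [h|h] := ltnP x.+1 d; first by rewrite modn_small // addnS.
(* At the last index [ordS] wraps around to 0, and [c (t + d) = c t] closes the cycle. *)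
have -> : x.+1 = d by lia.
by rewrite modnn addn0 ct -addnS; congr (c (_ + _)%N); lia.
Qed.

(* A vertex of the universal cover rooted at [i] is a nonbacktracking walk from
   [i], stored as a stack [(top, rest)]; [push] is the unique lift of a step. *)
Definition push (p : 'I_n * seq 'I_n) (u : 'I_n) : 'I_n * seq 'I_n :=
  if p.2 is b :: s' then if u == b then (b, s') else (u, p.1 :: p.2)
  else (u, p.1 :: p.2).

(** Total weight of the [m]-step walks whose lift from the cover vertex [p] ends at the root. *)
Fixpoint root_walks (m : nat) (p : 'I_n * seq 'I_n) : R :=
  if m is m'.+1 then \sum_u B p.1 u * root_walks m' (push p u)
  else (p.2 == [::])%:R.

Section Girth.
Variable g : nat.
Hypothesis no_cycle : forall k, (k < g)%N -> ~ has_cycle_of_length B k.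

Lemma closed_nbwalk_long i s :
  nbwalk (i :: s) -> last i s = i -> s != [::] -> (g <= size s)%N.
Proof.
move=> nb li s0; have [k ks ck] := closed_nbwalk_cycle nb li s0.
by rewrite leqNgt; apply/negP => sg; apply: (no_cycle _ ck); lia.
Qed.

(** Walks on the cover and on the graph take the same steps and differ only in the final test. A
    stack lying over the root vertex without being the root would be a closed nonbacktracking walk
    shorter than [g], as its depth never exceeds [size s + m]. *)
Lemma root_walksE m j s : nbwalk (j :: s) -> (size s + m < g)%N ->
  root_walks m (j, s) = (B ^+ m) j (last j s).
Proof.
elim: m j s => [|m IH] j s nb sg.
  rewrite expr0 [RHS]mxE /=; congr (_%:R); have [->|s0] := eqVneq s [::].
    by rewrite eqxx.
  case: eqVneq => // jl; have := closed_nbwalk_long nb (esym jl) s0; lia.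
rewrite exprS [RHS]mxE /=; apply: eq_bigr => u _.
have [->|Bju] := eqVneq (B j u) 0; first by rewrite !mul0r.
congr (_ * _); have uj : adj B u j by rewrite /adj Bsym.
rewrite /push /=; case: s nb sg => [|b s] nb sg.
  by rewrite IH //= ?uj //; lia.
have [ub|ub] := eqVneq u b.
  rewrite ub IH //; first by case/and3P: nb.
  by move: sg => /=; lia.
rewrite IH //; first by rewrite [nbwalk _]/= uj ub; exact: nb.
by move: sg => /=; lia.
Qed.
End Girth.

Section Dressed.
Variables (al w : 'I_n -> 'I_n -> R) (Z : 'I_n -> R).
Hypothesis Bge0 : forall i j, 0 <= B i j.
Hypothesis w_ge0 : forall i j, 0 <= w i j.
Hypothesis Z_ge0 : forall i, 0 <= Z i.
Hypothesis alE : forall i j, al j i = B i j * w i j.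
Hypothesis wE : forall i j, (1 - \sum_(k | k != i) al k j) * w i j = B i j.
Hypothesis ZE : forall j, (1 - \sum_k al k j) * Z j = 1.

(* The Green function of the universal cover. *)
Fixpoint dressed (j : 'I_n) (s : seq 'I_n) : R :=
  if s is b :: s' then w b j * dressed b s' else Z j.

Lemma dressed_ge0 j s : 0 <= dressed j s.
Proof. by elim: s j => [|b s IH] j //=; rewrite mulr_ge0. Qed.

(** The equation [(1 - B) dressed = delta_root] on the cover. Each step away from the root yields a
    factor [al]; these are summed by [ZE] at the root, and by [wE] elsewhere once the step back to
    the parent [b] is set apart. *)
Lemma dressedE j s : dressed j s =
  (s == [::])%:R + \sum_u B j u * dressed (push (j, s) u).1 (push (j, s) u).2.
Proof.
case: s => [|b s] /=.
  under eq_bigr do rewrite mulrA -alE.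
  by rewrite -mulr_suml -[true%:R]/1 -{1}(ZE j) mulrBl mul1r subrK.
have pb : push (j, b :: s) b = (b, s) by rewrite /push /= eqxx.
rewrite (bigD1 b) //= pb /= add0r.
rewrite (eq_bigr (fun u => al u j * (w b j * dressed b s))); last first.
  by move=> u ub; rewrite /push /= (negPf ub) /= mulrA -alE.
rewrite -mulr_suml Bsym -{1}(wE b j). ring.
Qed.

(** A nonnegative solution of the Green equation dominates every partial sum of the Neumann
    series. *)
Lemma sum_root_walks_le K j s : \sum_(m < K) root_walks m (j, s) <= dressed j s.
Proof.
elim: K j s => [|K IH] j s; first by rewrite big_ord0 dressed_ge0.
rewrite big_ord_recl /= dressedE lerD2l exchange_big ler_sum //= => u _.
rewrite -mulr_sumr ler_wpM2l //; case: (push _ _) => a b; exact: IH.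
Qed.

Lemma node_ge_closed_walks g i : (forall k, (k < g)%N -> ~ has_cycle_of_length B k) ->
  \sum_(m < g) (B ^+ m) i i <= Z i.
Proof.
move=> nc; apply: le_trans (sum_root_walks_le g i [::]).
by apply: ler_sum => m _; rewrite (root_walksE nc) /= ?add0n ?ltn_ord.
Qed.
End Dressed.
End NonBacktracking.

(** * Convergence of the messages *)

Section Messages.
Local Open Scope classical_set_scope.
Local Open Scope ring_scope.
Variables (R : realType) (n : nat) (A : 'M[R]_n).
Hypothesis Asym : forall i j, A i j = A j i.
Let B := absmx A.

(** These pairs certify all message bounds. [phi = 1] makes the denominators positive; [phi] a point
    mass makes [v] a column of the resolvent. *)
Definition poisson (phi v : 'I_n -> R) : Prop :=
  [/\ forall i, 0 <= phi i, forall i, 0 <= v i &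
      forall i, v i = phi i + \sum_k B i k * v k].

Lemma absmx_sym i j : B i j = B j i.
Proof. by rewrite !mxE Asym. Qed.

Lemma absmx_ge0 i j : 0 <= B i j.
Proof. by rewrite mxE. Qed.

(** Expand [v i] by the Poisson equation: the terms with [k != j] absorb the messages [a k i * v i],
    and what is left is the source and the term of [j]. *)
Lemma excl_bound (a : 'I_n -> 'I_n -> R) phi v i j : poisson phi v ->
  (forall k l, a k l * v l <= B k l * v k) ->
  phi i + B i j * v j <= (1 - \sum_(k | adj A i k && (k != j)) a k i) * v i.
Proof.
move=> [_ v0 vE] ha; rewrite mulrBl mul1r {1}(vE i) (bigD1 j) //= lerBrDr addrA lerD2l.
rewrite mulr_suml big_mkcondl ler_sum //= => k _; case: ifP => _.
  by rewrite absmx_sym.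
by rewrite mulr_ge0 // absmx_ge0.
Qed.

Section Positive.
Variable u : 'I_n -> R.
Hypothesis u_poisson : poisson (fun=> 1) u.

Lemma poisson1_gt0 i : 0 < u i.
Proof.
have [_ u0 uE] := u_poisson; rewrite uE ltr_pwDl // sumr_ge0 // => k _.
by rewrite mulr_ge0 // absmx_ge0.
Qed.

Lemma excl_lt1 (a : 'I_n -> 'I_n -> R) i j :
  (forall k l, a k l * u l <= B k l * u k) ->
  0 < 1 - \sum_(k | adj A i k && (k != j)) a k i.
Proof.
move=> ha; rewrite -(pmulr_lgt0 _ (poisson1_gt0 i)).
apply: lt_le_trans (excl_bound _ _ u_poisson ha).
by rewrite ltr_pwDl // mulr_ge0 ?absmx_ge0 // ltW // poisson1_gt0.
Qed.

(** One update preserves the invariant [a i j * v j <= B i j * v i]: since [A i j ^+ 2] is [B i j]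
    squared, it reduces to [B i j * v j <= d * v i], given by [excl_bound]. *)
Lemma message_bound (a : 'I_n -> 'I_n -> R) phi v i j : poisson phi v ->
  (forall k l, a k l * u l <= B k l * u k) ->
  (forall k l, a k l * v l <= B k l * v k) ->
  A i j ^+ 2 * (1 - \sum_(k | adj A i k && (k != j)) a k i)^-1 * v j <= B i j * v i.
Proof.
move=> vp hu hv; have := excl_bound i j vp hv; have := excl_lt1 i j hu.
set d := 1 - _ => d0 hd; have [phi0 v0 _] := vp.
have -> : A i j ^+ 2 = B i j * B i j by rewrite mxE -expr2 real_normK // num_real.
rewrite -!mulrA ler_wpM2l ?absmx_ge0 // mulrCA -ler_pdivlMl ?invr_gt0 // invrK.
by apply: le_trans hd; rewrite lerDr.
Qed.

Lemma alpha_seq_bound t phi v i j : poisson phi v ->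
  alpha_seq A t i j * v j <= B i j * v i.
Proof.
elim: t phi v i j => [|t IH] phi v i j vp /=.
  by rewrite mul0r mulr_ge0 ?absmx_ge0 //; case: vp.
(* The invariant for [u] keeps the denominator positive while the one for [v] is propagated; hence
   the induction over all Poisson pairs. *)
by apply: (@message_bound (alpha_seq A t) _ _ i j vp) => k l; [exact: IH u_poisson | exact: IH vp].
Qed.

Lemma alpha_seq_excl_lt1 t i j :
  0 < 1 - \sum_(k | adj A i k && (k != j)) alpha_seq A t k i.
Proof. by apply: excl_lt1 => k l; exact: alpha_seq_bound u_poisson. Qed.

Lemma alpha_seq_ge0 t i j : 0 <= alpha_seq A t i j.
Proof.
case: t => [|t] //=.
by rewrite mulr_ge0 ?sqr_ge0 // invr_ge0 ltW // alpha_seq_excl_lt1.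
Qed.

Lemma alpha_seq_nondecreasing i j : nondecreasing_seq (fun t => alpha_seq A t i j).
Proof.
apply/nondecreasing_seqP => t; elim: t i j => [|t IH] i j.
  exact: alpha_seq_ge0.
have := alpha_seq_excl_lt1 t.+1 i j; have := alpha_seq_excl_lt1 t i j => /= h1 h2.
rewrite ler_wpM2l ?sqr_ge0 // lef_pV2 ?posrE //.
by rewrite lerD2l lerN2 ler_sum // => k _; exact: IH.
Qed.

Lemma alpha_cvg i j : (fun t => alpha_seq A t i j) @ \oo --> alpha A i j.
Proof.
apply: nondecreasing_is_cvgn; first exact: alpha_seq_nondecreasing.
exists (B i j * u i / u j) => _ [t _ <-].
by rewrite ler_pdivlMr ?poisson1_gt0 // (alpha_seq_bound _ _ _ u_poisson).
Qed.

Lemma alpha_bound phi v i j : poisson phi v -> alpha A i j * v j <= B i j * v i.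
Proof.
move=> vp; have h : (fun t => alpha_seq A t i j * v j) @ \oo --> alpha A i j * v j.
  by apply: cvgMl; exact: alpha_cvg.
rewrite -(cvg_lim _ h) //; apply: limr_le; first by apply/cvg_ex; exists (alpha A i j * v j).
by near=> t; exact: alpha_seq_bound vp.
Unshelve. all: by end_near. Qed.

Lemma alpha_excl_lt1 i j : 0 < 1 - alpha_excl A i j.
Proof. by apply: excl_lt1 => k l; exact: alpha_bound u_poisson. Qed.

Lemma alpha_fixpoint i j : alpha A i j = A i j ^+ 2 * (1 - alpha_excl A i j)^-1.
Proof.
have h : (fun t => alpha_seq A t.+1 i j) @ \oo -->
    A i j ^+ 2 * (1 - alpha_excl A i j)^-1.
  apply: cvgMr; apply: cvgV; first by rewrite gt_eqF // alpha_excl_lt1.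
  apply: cvgB; first exact: cvg_cst.
  by apply: cvg_big => [|k _]; [exact: add_continuous | exact: alpha_cvg].
have := @alpha_cvg i j; rewrite -cvg_shiftS => h2.
exact: (cvg_unique _ h2 h).
Qed.

Lemma alpha_ge0 i j : 0 <= alpha A i j.
Proof.
by rewrite alpha_fixpoint mulr_ge0 ?sqr_ge0 // invr_ge0 ltW // alpha_excl_lt1.
Qed.

Lemma alpha_excl_bound i j phi v : poisson phi v ->
  phi i + B i j * v j <= (1 - alpha_excl A i j) * v i.
Proof. by move=> vp; apply: (excl_bound _ _ vp) => k l; exact: alpha_bound vp. Qed.

End Positive.
End Messages.

(** * Logarithm of a determinant near the identity *)

Lemma deriv_prod (R : comNzRingType) (I : finType) (F : I -> {poly R}) :
  (\prod_i F i)^`() = \sum_i (F i)^`() * \prod_(j | j != i) F j.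
Proof.
suff h (r : seq I) : uniq r -> (\prod_(i <- r) F i)^`() =
    \sum_(i <- r) (F i)^`() * \prod_(j <- r | j != i) F j.
  by apply: h; exact: index_enum_uniq.
elim: r => [|a r IH] /=; first by rewrite !big_nil derivC.
move=> /andP[ar ur]; rewrite !big_cons derivM IH // eqxx /=; congr (_ * _ + _).
  rewrite big_seq [RHS]big_seq_cond; apply: eq_bigl => i.
  by have [ir|] := boolP (i \in r); rewrite ?andbF //= (memPn ar).
rewrite big_distrr /= !big_seq; apply: eq_bigr => i ir.
by rewrite big_cons eq_sym (memPn ar) // mulrCA.
Qed.

(** Jacobi's formula, from the derivative of the Leibniz expansion. *)
Lemma deriv_det (R : comNzRingType) (n : nat) (M : 'M[{poly R}]_n) :
  (\det M)^`() = \tr (map_mx (@deriv R) M *m \adj M).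
Proof.
rewrite /mxtrace; under [RHS]eq_bigr do rewrite mxE.
have -> : (\det M)^`() = \sum_(s : {perm 'I_n}) \sum_i
    (M i (s i))^`() * ((-1) ^+ s * \prod_(j | j != i) M j (s j)).
  rewrite /determinant raddf_sum /=; apply: eq_bigr => s _.
  rewrite derivM deriv_prod -signr_odd.
  have -> : ((-1) ^+ odd s : {poly R})^`() = 0.
    by case: (odd s); rewrite ?expr1 ?derivN -?polyC1 ?derivC ?oppr0 // expr0 derivC.
  rewrite mul0r add0r mulr_sumr; apply: eq_bigr => i _.
  by rewrite signr_odd mulrCA.
rewrite exchange_big /=; apply: eq_bigr => i _.
(* Permutations with the same value at [i] together form a cofactor. *)
rewrite (partition_big (fun s : {perm 'I_n} => s i) predT) //=; apply: eq_bigr => j _.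
rewrite !mxE expand_cofactor mulr_sumr; apply: eq_bigr => s /eqP <-.
by congr (_ * (_ * _)); apply: eq_bigl => k; rewrite eq_sym.
Qed.

(** * Logarithm of [det (1 - W)] bounded by traces of a dominating matrix *)

Section LnDet.
Local Open Scope classical_set_scope.
Local Open Scope ring_scope.
Variables (R : realType) (N : nat) (W V : 'M[R]_N) (z : 'I_N -> R).
Hypothesis WV : forall e f, `|W e f| <= V e f.
Hypothesis z_ge0 : forall e, 0 <= z e.
Hypothesis zE : forall e, z e = 1 + \sum_f V e f * z f.

Let V_ge0 e f : 0 <= V e f.
Proof. exact: le_trans (normr_ge0 _) (WV e f). Qed.

Lemma expmx_dominated k e f : `|(W ^+ k) e f| <= (V ^+ k) e f.
Proof.
elim: k e f => [|k IH] e f; first by rewrite !expr0 !mxE; case: (_ == _); rewrite ?normr1 ?normr0.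
rewrite !exprS !mxE; apply: le_trans (ler_norm_sum _ _ _) _.
by apply: ler_sum => l _; rewrite normrM ler_pM.
Qed.

Lemma mxtrace_dominated k : `|\tr (W ^+ k)| <= \tr (V ^+ k).
Proof.
apply: le_trans (ler_norm_sum _ _ _) _.
by apply: ler_sum => e _; exact: expmx_dominated.
Qed.

Lemma supersolution_ge1 e : 1 <= z e.
Proof. by rewrite zE lerDl sumr_ge0 // => f _; rewrite mulr_ge0. Qed.

Lemma expmx_supersolution k e : \sum_f (V ^+ k) e f * z f <= z e.
Proof.
elim: k e => [|k IH] e.
  rewrite expr0 (bigD1 e) //= mxE eqxx mul1r big1 ?addr0 // => f fe.
  by rewrite mxE eq_sym (negPf fe) mul0r.
rewrite exprS; under eq_bigr => f _ do rewrite mxE mulr_suml.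
rewrite exchange_big /=; apply: (@le_trans _ _ (\sum_l V e l * z l)).
  apply: ler_sum => l _; under eq_bigr do rewrite -mulrA.
  by rewrite -mulr_sumr ler_wpM2l.
by rewrite [leRHS]zE lerDr.
Qed.

(** Holds because [V ^+ k] maps [z] below [z] and [z >= 1]. Boundedness is enough: for [s < 1] the
    factor [s ^+ K] removes the Neumann remainder. *)
Lemma expmx_bounded k e f : (V ^+ k) e f <= z e.
Proof.
apply: le_trans (expmx_supersolution k e).
rewrite (bigD1 f) //= -[leLHS]addr0 lerD //.
  by rewrite ler_peMr ?supersolution_ge1 // expmx_ge0.
by rewrite sumr_ge0 // => l _; rewrite mulr_ge0 // expmx_ge0.
Qed.

(** A left kernel vector [y] satisfies [|y| <= |y| V]. Pairing with [z] gives
    [sum |y| z <= sum |y| (z - 1)], hence [y = 0], even at [s = 1]. *)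
Lemma det_1sub_neq0 s : 0 <= s <= 1 -> \det (1%:M - s *: W) != 0.
Proof.
move=> /andP[s0 s1]; apply/det0P => -[y /eqP y0]; rewrite mulmxBr mulmx1 => /eqP.
rewrite subr_eq0 => /eqP yE; apply: y0.
have yle f : `|y 0 f| <= \sum_e `|y 0 e| * V e f.
  rewrite {1}yE mxE; apply: le_trans (ler_norm_sum _ _ _) _.
  apply: ler_sum => e _; rewrite mxE !normrM ler_wpM2l //.
  by rewrite -[leRHS]mul1r ler_pM // ger0_norm.
have : \sum_f `|y 0 f| * z f <= \sum_e `|y 0 e| * (z e - 1).
  apply: (@le_trans _ _ (\sum_f (\sum_e `|y 0 e| * V e f) * z f)).
    by apply: ler_sum => f _; rewrite ler_wpM2r.
  under eq_bigr do rewrite mulr_suml.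
  rewrite exchange_big /=; apply: ler_sum => e _.
  under eq_bigr do rewrite -mulrA.
  by rewrite -mulr_sumr (_ : z e - 1 = \sum_f V e f * z f) // zE addrAC subrr add0r.
under [leRHS]eq_bigr do rewrite mulrBr mulr1.
rewrite sumrB lerBrDr gerDl => h; apply/rowP => e; rewrite mxE; apply/eqP.
have /eqP : \sum_e `|y 0 e| = 0 by apply/le_anti; rewrite h sumr_ge0.
by rewrite psumr_eq0 // => /allP/(_ e (mem_index_enum _)); rewrite normr_eq0.
Qed.

Let p : {poly R} := \det (1%:M - 'X *: map_mx polyC W).

Let horner_mx1sub s : map_mx (horner_eval s) (1%:M - 'X *: map_mx polyC W) = 1%:M - s *: W.
Proof.
apply/matrixP => e f; rewrite !mxE /horner_eval !hornerE.
by case: (_ == _); rewrite /= ?hornerE.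
Qed.

Lemma horner_det_1sub s : p.[s] = \det (1%:M - s *: W).
Proof. by rewrite -[LHS]/(horner_eval s p) -det_map_mx horner_mx1sub. Qed.

Lemma deriv_det_1sub s : 0 <= s <= 1 ->
  p^`().[s] = - (p.[s] * \tr (W *m invmx (1%:M - s *: W))).
Proof.
move=> hs; have du : 1%:M - s *: W \in unitmx by rewrite unitmxE unitfE det_1sub_neq0.
rewrite deriv_det -[LHS]/(horner_eval s _) -trace_map_mx map_mxM map_mx_adj horner_mx1sub.
have -> : map_mx (horner_eval s) (map_mx (@deriv R) (1%:M - 'X *: map_mx polyC W)) = - W.
  apply/matrixP => e f; rewrite !mxE /horner_eval derivB derivM derivX derivC mul1r mulr0 addr0.
  by case: (_ == _); rewrite /= ?derivC -?polyC1 ?derivC !hornerE ?sub0r.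
rewrite mulNmx raddfN /= horner_det_1sub /invmx du -scalemxAr mxtraceZ.
by rewrite mulrA divff ?mul1r // -unitfE -unitmxE.
Qed.

(** The determinant is 1 at [s = 0] and never vanishes, so it cannot change sign. *)
Lemma det_1sub_gt0 s : 0 <= s <= 1 -> 0 < \det (1%:M - s *: W).
Proof.
move=> /andP[s0 s1]; rewrite -horner_det_1sub ltNge; apply/negP => ps.
have p0 : p.[0] = 1 by rewrite horner_det_1sub scale0r subr0 det1.
have [] := @IVT R (horner p) 0 s 0 s0.
- by apply: continuous_subspaceT; exact: continuous_horner.
- by rewrite p0 ge_min ps orbT le_max ler01.
move=> c; rewrite in_itv /= => /andP[c0 cs] /eqP.
by rewrite horner_det_1sub; apply/negP/det_1sub_neq0; rewrite c0 (le_trans cs).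
Qed.

Variables (g : nat) (T : R).
Hypothesis g_gt0 : (0 < g)%N.
Hypothesis trV0 : forall k, (0 < k < g)%N -> \tr (V ^+ k) = 0.
Hypothesis trV_le : forall K, \sum_(k < K) \tr (V ^+ k.+1) <= T.

(** In the Neumann series [sum s^k tr W^(k+1)] the terms with [k + 1 < g] vanish, and the others
    have [s^k <= s^(g-1)]. *)
Lemma log_derivative_le s : 0 < s < 1 ->
  `|\tr (W *m invmx (1%:M - s *: W))| <= T * s ^+ g.-1.
Proof.
move=> /andP[s0 s1]; set Q := invmx _.
have QE : Q = 1%:M + (s *: W) *m Q.
  apply/eqP; rewrite -subr_eq -{1}[Q]mul1mx -mulmxBl mulmxV //.
  by rewrite unitmxE unitfE det_1sub_neq0 // !ltW.
(* By [expmx_bounded], this bounds the trace of [W ^+ K.+1 *m Q] for every [K] at once. *)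
pose C := \sum_e \sum_f z e * `|Q f e|.
have sX k : (s *: W) ^+ k = s ^+ k *: W ^+ k.
  elim: k => [|k IH]; first by rewrite !expr0 scale1r.
  by rewrite !exprS IH -[LHS]/(_ *m _) -scalemxAl -scalemxAr scalerA.
have s0' := ltW s0; have s1' := ltW s1.
have hK K : `|\tr (W *m Q)| <= T * s ^+ g.-1 + s ^+ K * C.
  rewrite (geometric_mx1 K QE) sX mulmxDr raddfD /= mulmx_sumr raddf_sum /=.
  apply: le_trans (ler_normD _ _) _; apply: lerD; last first.
    rewrite -scalemxAl -scalemxAr mxtraceZ normrM ger0_norm ?exprn_ge0 //.
    rewrite ler_wpM2l ?exprn_ge0 // mulmxA -[W *m _]exprS.
    apply: le_trans (ler_norm_sum _ _ _) _; apply: ler_sum => e _; rewrite mxE.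
    apply: le_trans (ler_norm_sum _ _ _) _; apply: ler_sum => f _; rewrite normrM.
    by rewrite ler_wpM2r // (le_trans (expmx_dominated _ _ _)) // expmx_bounded.
  apply: le_trans (ler_norm_sum _ _ _) _.
  apply: (@le_trans _ _ (\sum_(k < K) \tr (V ^+ k.+1) * s ^+ g.-1)); last first.
    by rewrite -mulr_suml ler_wpM2r // exprn_ge0.
  apply: ler_sum => k _; rewrite sX -scalemxAr mxtraceZ -[W *m _]exprS normrM mulrC.
  rewrite (ger0_norm (exprn_ge0 _ s0')).
  have trk := mxtrace_dominated k.+1.
  have [kg|kg] := ltnP k.+1 g.
    by move: trk; rewrite trV0 // normr_le0 => /eqP ->; rewrite normr0 !mul0r.
  rewrite ler_pM ?exprn_ge0 // ler_wiXn2l //.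
  by move: kg; case: (g) g_gt0.
have h : (fun K => T * s ^+ g.-1 + s ^+ K * C) @ \oo --> T * s ^+ g.-1 + 0 * C.
  apply: cvgD; first exact: cvg_cst.
  by apply: cvgMl; apply: cvg_expr; rewrite ger0_norm ?ltW.
rewrite mul0r addr0 in h; rewrite -(cvg_lim _ h) //.
apply: limr_ge; first by apply/cvg_ex; exists (T * s ^+ g.-1).
by near=> K; exact: hK.
Unshelve. all: by end_near. Qed.

Lemma ln_det_le : `|ln (\det (1%:M - W))| <= T / g%:R.
Proof.
have pos (s : R) : 0 <= s <= 1 -> 0 < p.[s] by move=> hs; rewrite horner_det_1sub det_1sub_gt0.
have gR : 0 < g%:R :> R by rewrite ltr0n.
suff h (c : R) : `|c| = 1 -> c * ln (\det (1%:M - W)) <= T / g%:R.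
  rewrite ler_norml lerNl; apply/andP; split.
    by rewrite -mulN1r h // normrN normr1.
  by rewrite -[leLHS]mul1r h // normr1.
move=> c1.
(* The derivative of [q] is nonnegative on the open interval by [log_derivative_le], and [q 0 = 0];
   the claim is [0 <= q 1]. The signs [c = 1] and [c = -1] give the two halves of the absolute
   value. *)
pose q : R -> R := fun s => (T / g%:R) * s ^+ g - c * ln p.[s].
have dq (s : R) : 0 <= s <= 1 ->
    is_derive s 1 q (T * s ^+ g.-1 + c * \tr (W *m invmx (1%:M - s *: W))).
  move=> hs; have ps := pos s hs.
  have dl : is_derive s 1 (fun s => ln p.[s]) (p^`().[s] * p.[s]^-1).
    have := @is_derive1_comp R (@ln R) (horner p) s _ _ (is_derive1_ln ps) (is_derive_poly p s).
    by rewrite mulrC.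
  have -> : q = (fun s => (T / g%:R *: 'X^g).[s]) - (c *: (fun s => ln p.[s])).
    by apply: funext => x; rewrite /q !fctE hornerZ hornerXn.
  have -> : T * s ^+ g.-1 + c * \tr (W *m invmx (1%:M - s *: W)) =
     (T / g%:R *: 'X^g)^`().[s] - c *: (p^`().[s] * p.[s]^-1).
    rewrite derivZ derivXn hornerZ hornerMn hornerXn deriv_det_1sub //.
    rewrite mulNr (mulrAC p.[s]) divff ?gt_eqF // mul1r scalerN opprK; congr (_ + _).
    by rewrite mulrnAr -mulr_natl mulrA mulrCA mulfV ?mulr1 ?gt_eqF.
  by apply: is_deriveB; exact: is_derive_poly.
have qc : {within `[0, 1], continuous q}.
  apply: derivable_within_continuous => s; rewrite in_itv /= => hs.
  by have [] := dq s hs.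
have := @ger0_derive1_le_cc R q 0 1 _ _ qc 0 1.
rewrite !in_itv /= !lexx ler01 => H.
have {H} : q 0 <= q 1.
  apply: H => [s|s|//|//|//]; rewrite in_itv /= => /andP[s0 s1].
    by have [] := dq s; rewrite ?ltW.
  have -> : derive1 q s = T * s ^+ g.-1 + c * \tr (W *m invmx (1%:M - s *: W)).
    have hs : 0 <= s <= 1 by rewrite !ltW.
    by rewrite derive1E; have [_ ->] := dq s hs.
  rewrite -lerBlDr sub0r; apply: le_trans (log_derivative_le _); last by rewrite s0.
  by rewrite (le_trans (ler_norm _)) // normrN normrM c1 mul1r.
rewrite /q !horner_det_1sub scale0r subr0 det1 ln1 mulr0 subr0 scale1r.
by rewrite expr0n gtn_eqF // mulr0 expr1n mulr1 subr_ge0.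
Qed.
End LnDet.

(** * Directed edges and the Ihara-Bass identity *)

Section Sylvester.
Variable F : fieldType.

(** Sylvester's identity: two eliminations of the same block matrix lead to the two determinants. *)
Lemma det_1subC (m n : nat) (X : 'M[F]_(m, n)) (Y : 'M[F]_(n, m)) :
  \det (1%:M - X *m Y) = \det (1%:M - Y *m X).
Proof.
have h1 : block_mx 1%:M 0 (- Y) 1%:M *m block_mx 1%:M X Y 1%:M =
    block_mx 1%:M X 0 (1%:M - Y *m X).
  by rewrite mulmx_block !mul1mx !mul0mx !addr0 mulmx1 addNr mulNmx addrC.
have h2 : block_mx 1%:M (- X) 0 1%:M *m block_mx 1%:M X Y 1%:M =
    block_mx (1%:M - X *m Y) 0 Y 1%:M.
  by rewrite mulmx_block !mul1mx !mul0mx !add0r mulmx1 subrr mulNmx.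
have := congr1 determinant h1; have := congr1 determinant h2.
rewrite !det_mulmx det_lblock !det_ublock det_lblock !det1 !mul1r !mulr1.
by move=> <- <-.
Qed.

(** Matrix determinant lemma, with a solution [U] of [C U = T] in place of the inverse of [C]. *)
Lemma det_sub_mulmx (m n : nat) (C : 'M[F]_m) (T U : 'M[F]_(m, n)) (S : 'M[F]_(n, m)) :
  C *m U = T -> \det (C - T *m S) = \det C * \det (1%:M - S *m U).
Proof.
by move=> <-; rewrite -mulmxA -{1}[C]mulmx1 -mulmxBr det_mulmx det_1subC.
Qed.

Lemma det_block_diag (m : nat) (d1 d2 : 'rV[F]_m) :
  \det (block_mx 1%:M (diag_mx d1) (diag_mx d2) 1%:M) = \prod_x (1 - d1 0 x * d2 0 x).
Proof.
have h1 : block_mx 1%:M 0 (- diag_mx d2) 1%:M *m block_mx 1%:M (diag_mx d1) (diag_mx d2) 1%:M =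
    block_mx 1%:M (diag_mx d1) 0 (diag_mx (\row_x (1 - d1 0 x * d2 0 x))).
  rewrite mulmx_block !mul1mx !mul0mx !addr0 mulmx1 addNr mulNmx mulmx_diag.
  congr block_mx; apply/matrixP => x y; rewrite !mxE.
  by case: (_ == _); rewrite ?mulr0n ?oppr0 ?addr0 // !mulr1n mulrC addrC.
have := congr1 determinant h1.
rewrite det_mulmx det_lblock det_ublock !det1 !mul1r => ->.
by rewrite det_diag; apply: eq_bigr => x _; rewrite mxE.
Qed.
End Sylvester.

Section DirectedEdges.
Variable n : nat.

(** All pairs of distinct vertices are kept, adjacent or not, so the index type does not depend on
    [A]; nonedges will carry weight 0. *)
Definition upper : pred ('I_n * 'I_n) := fun p => (p.1 < p.2)%N.
Notation m := #|upper|.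

(* Edge [lshift _ x] runs along the pair [x] upwards, [rshift _ x] downwards. *)
Definition etail (e : 'I_(m + m)) : 'I_n :=
  match fintype.split e with inl x => (enum_val x).1 | inr x => (enum_val x).2 end.
Definition ehead (e : 'I_(m + m)) : 'I_n :=
  match fintype.split e with inl x => (enum_val x).2 | inr x => (enum_val x).1 end.
Definition eflip (e : 'I_(m + m)) : 'I_(m + m) :=
  match fintype.split e with inl x => rshift m x | inr x => lshift m x end.

Lemma split_lshift (x : 'I_m) : fintype.split (lshift m x) = inl x.
Proof. exact: (unsplitK (inl x)). Qed.

Lemma split_rshift (x : 'I_m) : fintype.split (rshift m x) = inr x.
Proof. exact: (unsplitK (inr x)). Qed.

Lemma eflip_lshift (x : 'I_m) : eflip (lshift m x) = rshift m x.
Proof. by rewrite /eflip split_lshift. Qed.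

Lemma eflip_rshift (x : 'I_m) : eflip (rshift m x) = lshift m x.
Proof. by rewrite /eflip split_rshift. Qed.

Lemma etail_lshift (x : 'I_m) : etail (lshift m x) = (enum_val x).1.
Proof. by rewrite /etail split_lshift. Qed.

Lemma etail_rshift (x : 'I_m) : etail (rshift m x) = (enum_val x).2.
Proof. by rewrite /etail split_rshift. Qed.

Lemma ehead_lshift (x : 'I_m) : ehead (lshift m x) = (enum_val x).2.
Proof. by rewrite /ehead split_lshift. Qed.

Lemma ehead_rshift (x : 'I_m) : ehead (rshift m x) = (enum_val x).1.
Proof. by rewrite /ehead split_rshift. Qed.

Definition edgeE := (eflip_lshift, eflip_rshift, etail_lshift, etail_rshift,
  ehead_lshift, ehead_rshift).

Lemma edge_ind (Q : 'I_(m + m) -> Prop) :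
  (forall x, Q (lshift m x)) -> (forall x, Q (rshift m x)) -> forall e, Q e.
Proof. by move=> h1 h2 e; rewrite -(splitK e); case: (fintype.split e). Qed.

Lemma etail_eflip e : etail (eflip e) = ehead e.
Proof. by elim/edge_ind: e => x; rewrite !edgeE. Qed.

Lemma ehead_eflip e : ehead (eflip e) = etail e.
Proof. by elim/edge_ind: e => x; rewrite !edgeE. Qed.

Lemma edge_inj e f : etail e = etail f -> ehead e = ehead f -> e = f.
Proof.
have inj (x y : 'I_m) : (enum_val x).1 = (enum_val y).1 ->
    (enum_val x).2 = (enum_val y).2 -> x = y.
  move=> h1 h2; apply: enum_val_inj.
  by rewrite [LHS]surjective_pairing [RHS]surjective_pairing h1 h2.
have lt (x : 'I_m) : ((enum_val x).1 < (enum_val x).2)%N := enum_valP x.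
elim/edge_ind: e => x; elim/edge_ind: f => y; rewrite !edgeE => h1 h2.
- by rewrite (inj x y).
- by have := lt x; have := lt y; rewrite h1 h2; lia.
- by have := lt x; have := lt y; rewrite h1 h2; lia.
- by rewrite (inj x y).
Qed.

Lemma eq_eflip e f : (f == eflip e) = (etail f == ehead e) && (ehead f == etail e).
Proof.
apply/eqP/andP => [->|[/eqP h1 /eqP h2]]; first by rewrite etail_eflip ehead_eflip.
by apply: edge_inj; rewrite ?etail_eflip ?ehead_eflip.
Qed.

Lemma sum_edges (V : nmodType) (F : 'I_n -> 'I_n -> V) :
  \sum_e F (etail e) (ehead e) = \sum_i \sum_(j | j != i) F i j.
Proof.
rewrite big_split_ord /=.
under eq_bigr do rewrite !edgeE.
under [X in _ + X]eq_bigr do rewrite !edgeE.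
rewrite -(big_enum_val (fun p => F p.1 p.2)) -(big_enum_val (fun p => F p.2 p.1)) /=.
transitivity (\sum_(i : 'I_n) \sum_(j : 'I_n | (i < j)%N) F i j +
              \sum_(i : 'I_n) \sum_(j : 'I_n | (j < i)%N) F i j).
  congr (_ + _); first by rewrite pair_big_dep.
  by rewrite [RHS](exchange_big_dep predT) //= pair_big_dep.
rewrite -big_split /=; apply: eq_bigr => i _.
rewrite [RHS](bigID (fun j : 'I_n => (i < j)%N)) /=.
by congr (_ + _); apply: eq_bigl => j; rewrite -val_eqE /=; lia.
Qed.

Lemma sum_edges_from (V : nmodType) (F : 'I_n -> 'I_n -> V) i :
  \sum_(e | etail e == i) F (etail e) (ehead e) = \sum_(j | j != i) F i j.
Proof.
rewrite big_mkcond (sum_edges (fun a b => if a == i then F a b else 0)).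
rewrite (bigD1 i) //= [X in _ + X]big1 ?addr0; first by rewrite eqxx.
by move=> a ai; rewrite big1 // => b _; rewrite (negPf ai).
Qed.

Lemma prod_upper (V : comPzRingType) (F : 'I_n -> 'I_n -> V) :
  \prod_x F (enum_val x : 'I_n * 'I_n).1 (enum_val (A := upper) x).2 =
  \prod_(i : 'I_n) \prod_(j : 'I_n | (i < j)%N) F i j.
Proof. by rewrite -(big_enum_val (fun p => F p.1 p.2)) /= pair_big_dep. Qed.

Definition nbmx (V : pzRingType) (w : 'I_n -> 'I_n -> V) : 'M[V]_(m + m) :=
  \matrix_(e, f) (w (etail f) (ehead f) *+ ((etail f == ehead e) && (ehead f != etail e))).

Definition startmx (V : pzRingType) (w : 'I_n -> 'I_n -> V) : 'M[V]_(n, m + m) :=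
  \matrix_(u, f) (w (etail f) (ehead f) *+ (etail f == u)).

Definition endmx (V : pzRingType) : 'M[V]_(m + m, n) := \matrix_(e, u) (ehead e == u)%:R.

Definition flipmx (V : pzRingType) (w : 'I_n -> 'I_n -> V) : 'M[V]_(m + m) :=
  \matrix_(e, f) (w (etail f) (ehead f) *+ (f == eflip e)).

(** A step may follow any edge leaving the head of [e] except the reversal of [e]. *)
Lemma nbmxE (V : pzRingType) (w : 'I_n -> 'I_n -> V) :
  nbmx w = endmx V *m startmx w - flipmx w.
Proof.
apply/matrixP => e f; rewrite !mxE (bigD1 (ehead e)) //= !mxE eqxx mul1r.
rewrite big1 ?addr0; last by move=> i ie; rewrite mxE eq_sym (negPf ie) mul0r.
rewrite eq_eflip; case: (_ == ehead e); case: (_ == etail e); rewrite ?subr0 ?subrr //.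
Qed.

Section IharaBass.
Variables (F : fieldType) (A : 'M[F]_n) (al w : 'I_n -> 'I_n -> F) (Z : 'I_n -> F).
Hypothesis Adiag : forall i, A i i = 0.
Hypothesis aldiag : forall i, al i i = 0.
Hypothesis ww_neq1 : forall i j, 1 - w i j * w j i != 0.
Hypothesis wZ : forall i j, w i j = A i j * Z j * (1 - w i j * w j i).
Hypothesis wwZ : forall i j, w i j * w j i = al j i * Z i * (1 - w i j * w j i).
Hypothesis ZE : forall j, (1 - \sum_k al k j) * Z j = 1.

(** The candidate for [(1 + flipmx w)^-1 endmx]. Each edge is coupled only with its reversal, which
    leaves 2 by 2 systems of determinant [1 - w i j * w j i]. *)
Let U : 'M[F]_(m + m, n) := \matrix_(e, u)
  (((ehead e == u)%:R - w (ehead e) (etail e) * (etail e == u)%:R) /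
   (1 - w (etail e) (ehead e) * w (ehead e) (etail e))).

Lemma flipmx_solve : (1%:M + flipmx w) *m U = endmx F.
Proof.
apply/matrixP => e u; rewrite mulmxDl mul1mx !mxE (bigD1 (eflip e)) //= !mxE eqxx mulr1n.
rewrite big1 ?addr0; last by move=> f fe; rewrite mxE (negPf fe) mul0r.
rewrite etail_eflip ehead_eflip.
have := ww_neq1 (etail e) (ehead e); rewrite [w (ehead e) _ * w _ (ehead e)]mulrC => h.
by field.
Qed.

Lemma det_flipmx : \det (1%:M + flipmx w) =
  \prod_(i : 'I_n) \prod_(j : 'I_n | (i < j)%N) (1 - w i j * w j i).
Proof.
rewrite -(prod_upper (fun i j => 1 - w i j * w j i)).
pose d1 : 'rV[F]_m := \row_x w (enum_val x).2 (enum_val x).1.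
pose d2 : 'rV[F]_m := \row_x w (enum_val x).1 (enum_val x).2.
have -> : 1%:M + flipmx w = block_mx 1%:M (diag_mx d1) (diag_mx d2) 1%:M.
  apply/matrixP => e f; elim/edge_ind: e => x; elim/edge_ind: f => y.
  - by rewrite block_mxEul !mxE !edgeE eq_lrshift addr0 eq_lshift.
  - rewrite block_mxEur !mxE !edgeE eq_lrshift add0r eq_rshift [x == y]eq_sym.
    by case: eqVneq => [->|].
  - rewrite block_mxEdl !mxE !edgeE eq_rlshift add0r eq_lshift [x == y]eq_sym.
    by case: eqVneq => [->|].
  - by rewrite block_mxEdr !mxE !edgeE eq_rlshift addr0 eq_rshift.
rewrite det_block_diag; apply: eq_bigr => x _.
by rewrite !mxE mulrC.
Qed.

(** [wZ] and [wwZ] clear the denominators; by [ZE] the diagonal becomes [1 + (sum of al) Z = Z]. *)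
Lemma startmx_solve : 1%:M - startmx w *m U = (1%:M - A) *m diag_mx (\row_i Z i).
Proof.
apply/matrixP => u v; rewrite mul_mx_diag !mxE.
pose F' i j := w i j * (((j == v)%:R - w j i * (i == v)%:R) / (1 - w i j * w j i)).
have -> : \sum_e startmx w u e * U e v = \sum_(j | j != u) F' u j.
  rewrite -sum_edges_from [RHS]big_mkcond; apply: eq_bigr => e _.
  by rewrite !mxE /F'; case: (_ == u); rewrite ?mulr1n // mulr0n mul0r.
have F'E j : F' u j = (A u j * Z j) * (j == v)%:R - (al j u * Z u) * (u == v)%:R.
  rewrite /F'; have h := ww_neq1 u j; apply: (mulIf h).
  rewrite mulrA divfK // mulrBl mulrAC -wZ [_ * _ * (1 - _)]mulrAC -wwZ.
  by rewrite mulrBr !mulrA.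
under eq_bigr do rewrite F'E.
rewrite sumrB -mulr_suml -mulr_suml.
have -> : \sum_(j < n | j != u) al j u = \sum_j al j u.
  by rewrite [RHS](bigD1 u) //= aldiag add0r.
have -> : \sum_(j | j != u) A u j * Z j * (j == v)%:R = A u v * Z v.
  transitivity (\sum_j A u j * Z j * (j == v)%:R).
    by rewrite [RHS](bigD1 u) //= Adiag !mul0r add0r.
  rewrite (bigD1 v) //= eqxx mulr1 big1 ?addr0 // => j /negPf ->.
  by rewrite mulr0.
have zu := ZE u; have [->|uv] := eqVneq u v; last first.
 by rewrite /= !mulr0n; ring.
rewrite /= !mulr1n; move: (ZE v); rewrite mulrBl mul1r => h; rewrite -{1}h; ring.
Qed.

Lemma ihara_bass : \det (1%:M - nbmx w) =
  (\prod_(i : 'I_n) \prod_(j : 'I_n | (i < j)%N) (1 - w i j * w j i)) *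
  (\det (1%:M - A) * \prod_i Z i).
Proof.
rewrite nbmxE opprB addrA.
rewrite (det_sub_mulmx _ flipmx_solve) det_flipmx startmx_solve det_mulmx det_diag.
by congr (_ * (_ * _)); apply: eq_bigr => i _; rewrite mxE.
Qed.
End IharaBass.
End DirectedEdges.

(** * The belief-propagation estimate *)

Section BeliefPropagation.
Variables (R : realType) (n : nat) (A : 'M[R]_n).
Hypothesis Asym : forall i j, A i j = A j i.
Hypothesis Adiag : forall i, A i i = 0.
Let B := absmx A.
Variable u : 'I_n -> R.
Hypothesis u_poisson : poisson A (fun=> 1) u.

Let al := alpha A.
Let d i j := 1 - alpha_excl A i j.
Let s i := 1 - \sum_k al k i.

Definition dressed_weight i j : R := A i j * (1 - alpha_excl A j i)^-1.
Let w := dressed_weight.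
Let wabs i j := `|w i j|.

Let d_gt0 i j : 0 < d i j.
Proof. exact: alpha_excl_lt1 u_poisson _ _. Qed.

Let alE i j : al i j = A i j ^+ 2 * (d i j)^-1.
Proof. exact: alpha_fixpoint u_poisson _ _. Qed.

Let al_ge0 i j : 0 <= al i j.
Proof. exact: alpha_ge0 u_poisson _ _. Qed.

Let al0 i j : ~~ adj A j i -> al i j = 0.
Proof. by rewrite /adj negbK => /eqP h; rewrite alE Asym h expr0n mul0r. Qed.

Let al_diag i : al i i = 0.
Proof. by rewrite al0 // /adj Adiag eqxx. Qed.

Let exclE i j : alpha_excl A i j = \sum_(k | k != j) al k i.
Proof.
rewrite /alpha_excl big_mkcondl; apply: eq_bigr => k _.
by case: ifPn => // /al0.
Qed.

Let nodeE i : Zbp_node A i = (s i)^-1.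
Proof.
rewrite /Zbp_node /s; congr (1 - _)^-1; rewrite big_mkcond; apply: eq_bigr => k _.
by case: ifPn => // /al0.
Qed.

Let sE i j : s i = d i j - al j i.
Proof. by rewrite /s /d exclE [in LHS](bigD1 j) //= opprD addrCA addrC. Qed.

Let s_gt0 i : 0 < s i.
Proof. by rewrite (sE i i) al_diag subr0 d_gt0. Qed.

Let s_le1 i : s i <= 1.
Proof. by rewrite /s gerBl sumr_ge0. Qed.

Let wwE i j : 1 - w i j * w j i = s j / d j i.
Proof.
rewrite (sE j i) alE /w /dressed_weight (Asym j i) -/(d j i) -/(d i j).
by have h1 := lt0r_neq0 (d_gt0 i j); have h2 := lt0r_neq0 (d_gt0 j i); field; rewrite h1 h2.
Qed.

Let wwE' i j : 1 - w i j * w j i = s i / d i j.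
Proof. by rewrite mulrC wwE. Qed.

Let edgeE' i j : Zbp_edge A i j = (d i j * d j i - A i j ^+ 2)^-1.
Proof.
rewrite /Zbp_edge; congr (_^-1).
rewrite (expand_det_row _ ord0) !big_ord_recl big_ord0 /cofactor !det_mx11 !mxE /=.
rewrite -/(d i j) -/(d j i). ring.
Qed.

(** Writing [s_i] for the inverse of the node factor, an edge factor equals [s_i s_j / (s_i d_ji) =
    s_j / d_ji = 1 - w_ij w_ji], the factor in [ihara_bass]. Nonadjacent pairs have [w = 0] and
    contribute 1. *)
Lemma ZbpE : Zbp A / Zpart A = \det (1%:M - nbmx w).
Proof.
rewrite (@ihara_bass _ _ A al w (fun i => (s i)^-1)) => //; last 4 first.
- by move=> i j; rewrite wwE mulf_neq0 ?invr_eq0 ?gt_eqF.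
- move=> i j; rewrite wwE [RHS]mulrA divfK ?gt_eqF //.
- move=> i j; rewrite wwE' [RHS]mulrA divfK ?gt_eqF //.
  by rewrite /w /dressed_weight alE -/(d j i) -/(d i j) (Asym j i); ring.
- by move=> j; rewrite -/(s j) mulfV // gt_eqF.
rewrite /Zpart invrK mulrC [RHS]mulrC -mulrA; congr (_ * _); rewrite /Zbp.
congr (_ * _); first by apply: eq_bigr => i _; exact: nodeE.
apply: eq_bigr => i _; rewrite big_mkcondr; apply: eq_bigr => j _.
case: ifPn => [_|]; last first.
  by rewrite /adj negbK => /eqP h; rewrite /w /dressed_weight h !mul0r subr0.
rewrite !nodeE edgeE' wwE.
have -> : d i j * d j i - A i j ^+ 2 = s i * d j i.
  by rewrite (sE i j) [RHS]mulrBl alE (Asym j i) divfK // gt_eqF.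
by rewrite !invfM !invrK mulrACA mulVf ?gt_eqF // mul1r mulrC.
Qed.

Let wabsE i j : wabs i j = B i j * (d j i)^-1.
Proof.
rewrite /wabs /w /dressed_weight normrM -/(d j i) [B i j]mxE normfV.
by rewrite (gtr0_norm (d_gt0 j i)).
Qed.

Let wabs_d i j : d j i * wabs i j = B i j.
Proof. by rewrite wabsE mulrCA mulfV ?mulr1 // gt_eqF. Qed.

Let wabs_B i j : B i j * wabs i j = al j i.
Proof.
rewrite wabsE alE mulrA; congr (_ * _).
by rewrite [B i j]mxE -expr2 real_normK ?num_real // Asym.
Qed.

Lemma nbmx_dominated e f : `|nbmx w e f| <= nbmx wabs e f.
Proof. by rewrite !mxE normrMn. Qed.

(* Sum over the dressed nonbacktracking walks continuing [e], expressed through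
   the solution [v] of [v = phi + |A| v]. *)
Let zeta (v : 'I_n -> R) e :=
  d (ehead e) (etail e) * v (ehead e) - B (etail e) (ehead e) * v (etail e).

Let zeta_ge0 phi v e : poisson A phi v -> 0 <= zeta v e.
Proof.
move=> vp; have := alpha_excl_bound Asym u_poisson (ehead e) (etail e) vp.
have [phi0 _ _] := vp; rewrite subr_ge0 (absmx_sym Asym (etail e)); apply: le_trans.
by rewrite lerDr.
Qed.

Let zeta_step phi v a : poisson A phi v ->
  \sum_b (B a b * v b - al b a * v a) = s a * v a - phi a.
Proof.
move=> [_ _ vE]; rewrite sumrB -mulr_suml /s mulrBl mul1r {2}(vE a).
by rewrite addrAC [phi a + _]addrC addrK.
Qed.

Let wabs_zeta v a b : wabs a b * (d b a * v b - B a b * v a) = B a b * v b - al b a * v a.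
Proof. by rewrite mulrBr !mulrA (mulrC _ (d b a)) wabs_d (mulrC _ (B a b)) wabs_B. Qed.

(** By [wabs_zeta] a step from [j] to [b] contributes [H b]. Over all [b] these add up to
    [s j * v j - phi j]; removing the reversal [b = i] and using [s j = d j i - al i j] gives
    [zeta v e - phi j]. *)
Let zetaE phi v e : poisson A phi v ->
  zeta v e = phi (ehead e) + \sum_f nbmx wabs e f * zeta v f.
Proof.
move=> vp; set i := etail e; set j := ehead e.
pose F a b := wabs a b *+ ((a == j) && (b != i)) * (d b a * v b - B a b * v a).
have -> : \sum_f nbmx wabs e f * zeta v f = \sum_f F (etail f) (ehead f).
  by apply: eq_bigr => f _; rewrite mxE.
rewrite sum_edges (bigD1 j) //= [X in _ + (_ + X)]big1 ?addr0; last first.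
  by move=> a aj; rewrite big1 // => b _; rewrite /F (negPf aj) mul0r.
pose H b := B j b * v b - al b j * v j.
have -> : \sum_(b < n | b != j) F j b = \sum_(b < n | b != i) H b.
  have Hj : H j = 0 by rewrite /H al_diag mxE Adiag normr0 !mul0r subrr.
  transitivity (\sum_(b < n) (if b != i then H b else 0)); last by rewrite -big_mkcond.
  rewrite [RHS](bigD1 j) //= Hj if_same add0r; apply: eq_bigr => b _.
  by rewrite /F eqxx /=; case: (b != i); rewrite ?mulr1n ?mulr0n ?mul0r // wabs_zeta.
have := zeta_step j vp; rewrite (bigD1 i) //= -/(H i) => h.
rewrite -[X in _ + X](addKr (H i)) h /H /zeta -/i -/j (sE j i) (absmx_sym Asym i j).
ring.
Qed.

Let start_zeta phi v a : poisson A phi v ->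
  \sum_f startmx wabs a f * zeta v f = s a * v a - phi a.
Proof.
move=> vp; rewrite -(zeta_step a vp) [RHS](bigD1 a) //= mxE Adiag normr0 al_diag !mul0r subrr add0r.
pose F a b := wabs a b * (d b a * v b - B a b * v a).
transitivity (\sum_(b | b != a) F a b); last by apply: eq_bigr => b _; exact: wabs_zeta.
rewrite -sum_edges_from [RHS]big_mkcond; apply: eq_bigr => f _.
by rewrite mxE; case: eqP => _; rewrite ?mulr1n // mulr0n mul0r.
Qed.

Let wabs_ge0 a b : 0 <= wabs a b. Proof. exact: normr_ge0. Qed.

Let nbmx_ge0 e f : 0 <= nbmx wabs e f.
Proof. by rewrite mxE mulrn_wge0. Qed.

Let startmx_ge0 a f : 0 <= startmx wabs a f.
Proof. by rewrite mxE mulrn_wge0. Qed.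

Lemma trace_nbmx_le (G : 'M[R]_n) K :
  (forall i j, 0 <= G i j) -> G = 1%:M + B *m G ->
  \sum_(k < K) \tr (nbmx wabs ^+ k.+1) <= \sum_i (G i i - Zbp_node A i).
Proof.
move=> G0 GE; set V := nbmx wabs; set S := startmx wabs; set E := @endmx n R.
have Gp l : poisson A (fun i => (i == l)%:R) (fun i => G i l).
  split=> [i|//|i]; first exact: ler0n.
  by rewrite {1}GE !mxE.
pose Y := \matrix_(e, l) zeta (fun i => G i l) e.
have YE : Y = E + V *m Y.
  apply/matrixP => e l; rewrite !mxE (zetaE e (Gp l)); congr (_ + _).
  by apply: eq_bigr => f _; rewrite [Y _ _]mxE.
have SY i : (S *m Y) i i = s i * G i i - 1.
  rewrite mxE; have := start_zeta i (Gp i); rewrite eqxx => <-.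
  by apply: eq_bigr => f _; rewrite [Y _ _]mxE.
have Y0 e l : 0 <= Y e l by rewrite mxE (zeta_ge0 _ (Gp l)).
(* [s_i G_ii - 1] is nonnegative, so dividing it by [s_i <= 1] can only enlarge it, and the quotient
   is [G_ii] minus the node factor. *)
apply: (@le_trans _ _ (\tr (S *m Y))); last first.
  apply: ler_sum => i _; rewrite nodeE.
  have h : 0 <= s i * G i i - 1 by rewrite -SY mulmx_ge0.
  have -> : G i i - (s i)^-1 = (s i * G i i - 1) / s i.
    by rewrite mulrBl mul1r mulrAC mulfV ?mul1r // gt_eqF.
  by rewrite SY ler_pdivlMr // ler_piMr.
(* One factor [V] is replaced by the entrywise larger [E *m S], which drops [flipmx], and the trace
   is rotated. *)
apply: (@le_trans _ _ (\sum_(k < K) \tr (S *m (V ^+ k *m E)))).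
  apply: ler_sum => k _; rewrite mulmxA mxtrace_mulC mulmxA [in leRHS]mxtrace_mulC.
  rewrite mulmxA -mulmxA exprSr -[V ^+ k * V]/(_ *m _).
  apply: ler_sum => e _; rewrite !mxE; apply: ler_sum => f _.
  rewrite ler_wpM2l ?expmx_ge0 // /V nbmxE [leLHS]mxE gerDl mxE oppr_le0 mxE.
  by rewrite mulrn_wge0.
(* By [YE], [Y] exceeds the partial sum of [V ^+ k *m E] by the nonnegative [V ^+ K *m Y]. *)
rewrite -raddf_sum -mulmx_sumr /= -subr_ge0 -raddfB /= -mulmxBr.
apply: sumr_ge0 => i _; apply: mulmx_ge0 => // e l.
rewrite {1}(geometric_mx K YE) [X in 0 <= fun_of_matrix X _ _]addrAC subrr add0r.
by apply: mulmx_ge0 => //; apply: expmx_ge0.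
Qed.

(** The walk begins at the head of [e] and takes [k.+1] steps; for [e = f] it is closed, which
    confronts nonzero traces with the girth. *)
Lemma nbmx_walk k e f : (nbmx wabs ^+ k.+1) e f != 0 ->
  exists t, [/\ nbwalk B [:: ehead f, etail f & t], last (etail f) t = ehead e
                & size t = k].
Proof.
have step e' f' : nbmx wabs e' f' != 0 ->
    [/\ etail f' = ehead e', ehead f' != etail e' & adj B (ehead f') (etail f')].
  rewrite mxE; case: andP => [[/eqP h1 h2]|]; last by rewrite mulr0n eqxx.
  rewrite mulr1n wabsE => h3; split=> //; apply: contraNneq h3 => h3.
  by rewrite (absmx_sym Asym) h3 mul0r.
elim: k f => [|k IH] f.
  rewrite expr1 => /step[h1 h2 h3]; exists [::]; split=> //=.
  by rewrite h3.
rewrite exprSr mxE => h.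
have [l] : exists l, (nbmx wabs ^+ k.+1) e l * nbmx wabs l f != 0.
  apply/existsP; apply: contraNT h => /existsPn h; rewrite big1 // => l _.
  by apply/eqP; have := h l; rewrite negbK.
rewrite mulf_eq0 negb_or => /andP[/IH[t [t1 t2 t3]] /step[h1 h2 h3]].
exists (etail l :: t); split=> /=; last by rewrite t3.
  by rewrite h3 h2 h1 /=; exact: t1.
exact: t2.
Qed.

Lemma absmx_no_cycle g : (forall k, (k < g)%N -> ~ has_cycle_of_length A k) ->
  forall k, (k < g)%N -> ~ has_cycle_of_length B k.
Proof.
move=> nc k kg [c [c1 [c2 c3]]]; apply: (nc k kg); exists c; split=> //; split=> // t.
by have := c3 t; rewrite /adj mxE normr_eq0.
Qed.

Lemma absmx_diag i : B i i = 0.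
Proof. by rewrite mxE Adiag normr0. Qed.

Section Girth.
Variable g : nat.
Hypothesis no_cycle : forall k, (k < g)%N -> ~ has_cycle_of_length A k.

Lemma trace_nbmx_eq0 k : (0 < k < g)%N -> \tr (nbmx wabs ^+ k) = 0.
Proof.
case: k => // k /= kg; apply: big1 => e _; apply/eqP/negPn/negP => /nbmx_walk[t [t1 t2 t3]].
have := closed_nbwalk_long absmx_diag (absmx_no_cycle no_cycle) t1 t2 isT.
by rewrite /= t3 leqNgt kg.
Qed.

Lemma node_ge i : \sum_(m < g) (B ^+ m) i i <= Zbp_node A i.
Proof.
apply: (@node_ge_closed_walks _ _ B (absmx_sym Asym) absmx_diag al wabs).
- exact: absmx_ge0.
- exact: wabs_ge0.
- by move=> j; rewrite nodeE invr_ge0 ltW.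
- by move=> a b; rewrite wabs_B.
- by move=> a b; rewrite -exclE wabs_d.
- by move=> j; rewrite nodeE -/(s j) mulfV // gt_eqF.
- exact: absmx_no_cycle.
Qed.

Lemma ln_Zbp_le (G : 'M[R]_n) (T : R) : (0 < g)%N ->
  (forall i j, 0 <= G i j) -> G = 1%:M + B *m G ->
  \tr G - \sum_(m < g) \tr (B ^+ m) <= T ->
  `|ln (Zbp A / Zpart A)| <= T / g%:R.
Proof.
move=> g0 G0 GE hT; rewrite ZbpE.
apply: (@ln_det_le _ _ _ (nbmx wabs) (zeta u)) => //.
- exact: nbmx_dominated.
- by move=> e; apply: zeta_ge0 u_poisson.
- by move=> e; exact: zetaE u_poisson.
- exact: trace_nbmx_eq0.
move=> K; apply: le_trans (trace_nbmx_le K G0 GE) _; apply: le_trans hT.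
(* Each node factor is bounded below by the closed walks of length less than [g]. *)
rewrite sumrB lerD2l lerN2 exchange_big /=; apply: ler_sum => i _; exact: node_ge.
Qed.
End Girth.
End BeliefPropagation.

Theorem theorem3 (R : realType) (n : nat) (A : 'M[R]_n) (g : nat) :
  (forall i j, A i j = A j i) ->
  (forall i, A i i = 0) ->
  spectral_radius (absmx A) < 1 ->
  is_girth A g ->
  n%:R^-1 * `| ln (Zbp A / Zpart A) |
    <= spectral_radius (absmx A) ^+ g
       / (g%:R * (1 - spectral_radius (absmx A))).
Proof.
move=> Asym Adiag rho1 [[c [g3 _]] no_cycle].
have g0 : (0 < g)%N by lia.
have n0 : (0 < n)%N by exact: leq_ltn_trans (ltn_ord (c (Ordinal g0))).
have Bsym := absmx_sym Asym; have B0 := @absmx_ge0 _ _ A.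
have GE := resolventE Bsym B0 rho1; have G0 := resolvent_ge0 Bsym B0 rho1.
have tail := trace_tail_le Bsym B0 rho1 g.
set G := invmx _ in GE G0 tail; set rho := spectral_radius _ in rho1 tail *.
(* The row sums of the resolvent solve the Poisson equation with source 1, which starts all message
   bounds. *)
have up : poisson A (fun=> 1) (fun i => \sum_l G i l).
  split=> [//|i|i]; first by rewrite sumr_ge0.
  rewrite {1}GE; under eq_bigr do rewrite mxE.
  rewrite big_split /=; congr (_ + _).
    rewrite (bigD1 i) //= mxE eqxx big1 ?addr0 // => l li.
    by rewrite mxE eq_sym (negPf li).
  by under eq_bigr do rewrite mxE; rewrite exchange_big; apply: eq_bigr => k _; rewrite mulr_sumr.
have := ln_Zbp_le Asym Adiag up no_cycle g0 G0 GE tail.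
rewrite -(ler_pM2l (x := n%:R^-1)) ?invr_gt0 ?ltr0n // => /le_trans; apply.
rewrite le_eqVlt; apply/orP; left; apply/eqP; field.
by rewrite !pnatr_eq0 -!lt0n n0 g0 subr_eq0 gt_eqF.
Qed.
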